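(* If $M$ is an $I_4$-free and triangle-free matroid, then $\chi(M)\le 2$.
   Context: A matroid here means a pair $M=(E,G)$, where $G=\mathrm{PG}(n-1,2)$ is identified with $\mathbb F_2^n\setminus\{0\}$ ($n\ge 1$) and $E\subseteq G$ is arbitrary; $n$ is the dimension of $M$. A flat of $G$ is a set $F\subseteq G$ with $F\cup\{0\}$ a linear subspace (the empty set is the flat of dimension $0$). A triangle is a $2$-dimensional flat. $M$ is $I_4$-free if there is no $4$-dimensional flat $F$ of $G$ such that $E\cap F$ is a basis of $F$. $M$ is triangle-free if $E$ contains no triangle of $G$. The critical number of an $n$-dimensional matroid $M=(E,G)$ is $\chi(M)=n-k$, where $k$ is the dimension of a largest flat of $G$ contained in $G\setminus E$. *)

(* Defs.v *)
From mathcomp Require Import all_boot all_order all_algebra.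

Set Implicit Arguments.
Unset Strict Implicit.
Unset Printing Implicit Defensive.

Import GRing.Theory.
Local Open Scope ring_scope.

(* The points of PG(n-1,2). *)
Definition PG (n : nat) : {set 'rV['F_2]_n} := [set~ 0].

Record matroid (n : nat) := Matroid {
  elements : {set 'rV['F_2]_n};
  elements_sub : elements \subset PG n
}.

(* [F :|: [set 0]] is a linear subspace, expressed as a boolean by saying that
   it equals its own linear span; see [flatP]. *)
Definition flat (n : nat) (F : {set 'rV['F_2]_n}) : bool :=
  (F \subset PG n) && (F :|: [set 0] == [set x in <<enum F>>%VS]).

Definition flat_dim (n : nat) (F : {set 'rV['F_2]_n}) : nat :=
  \dim <<enum F>>%VS.

Lemma flatP (n : nat) (F : {set 'rV['F_2]_n}) :
  reflect (F \subset PG n /\ submod_closed (F :|: [set 0])) (flat F).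
Proof.
apply: (iffP andP) => -[sF hF]; split=> //.
  rewrite (eqP hF); split=> [|a u v]; rewrite !inE; first exact: mem0v.
  by move=> uF vF; rewrite memvD // memvZ.
case: hF => h0 hl; apply/eqP/setP=> x; rewrite [RHS]inE; apply/idP/idP.
  rewrite !inE => /orP[xF|/eqP->]; last exact: mem0v.
  by apply: memv_span; rewrite mem_enum.
move=> xF; rewrite (@coord_span _ _ _ (in_tuple (enum F)) x xF).
elim/big_rec: _ => [|i y _ yF]; first exact: h0.
apply: hl yF; rewrite inE; apply/orP; left.
by rewrite -mem_enum; apply: mem_nth.
Qed.

Definition I4_free (n : nat) (M : matroid n) : Prop :=
  ~ exists F : {set 'rV['F_2]_n},
      [/\ flat F, flat_dim F = 4%N
        & basis_of <<enum F>>%VS (enum (elements M :&: F))].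

Definition triangle (n : nat) (F : {set 'rV['F_2]_n}) : bool :=
  flat F && (flat_dim F == 2%N).

Definition triangle_free (n : nat) (M : matroid n) : Prop :=
  ~ exists F : {set 'rV['F_2]_n}, triangle F /\ F \subset elements M.

(* The maximum ranges over a nonempty family of flats (the empty flat belongs
   to it) of dimension at most [n], so the subtraction does not truncate. *)
Definition critical_number (n : nat) (M : matroid n) : nat :=
  (n - \max_(F : {set 'rV['F_2]_n}
             | flat F && (F \subset PG n :\: elements M)) flat_dim F)%N.

(* Main.v *)
(** Over [F_2], a triangle-free set [E] is a sum-free set, and [I_4]-freeness
says that any four points of [E] have a three-term or the four-term sum in [E].
If no linear functional equals [1] on all of [E], then [E] contains an odd
circuit, and a shortest one has five points [a], ..., [e].  If [E] is invariant
under a nonzero translation [w], restrict to a hyperplane avoiding [w] and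
induct.  Otherwise each further point [y] of [E] determines a triple of the
five points, by which pairs [y] can be translated within [E], and the triple is
the same for all [y]; say it is [a], [b], [c].  Then [E] minus [d] and [e],
together with [d + e], is an affine subspace, so some functional [f] is [1] on
[E] minus [d]; with any [g] that is nonzero at [d], the common kernel of [f]
and [g] avoids [E]. *)

Require Import Defs.
From mathcomp Require Import all_boot all_order all_algebra.

Set Implicit Arguments.
Unset Strict Implicit.
Unset Printing Implicit Defensive.

Import GRing.Theory.
Local Open Scope ring_scope.

(** * Sums in groups of exponent two *)

Inductive sum_expr := Zero | Atom of nat | Sum of sum_expr & sum_expr.

Fixpoint sum_eval (V : nmodType) (env : seq V) (t : sum_expr) : V :=
  match t with
  | Zero => 0
  | Atom i => env`_i
  | Sum t1 t2 => sum_eval env t1 + sum_eval env t2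
  end.

Fixpoint sum_parity (t : sum_expr) (i : nat) : bool :=
  match t with
  | Zero => false
  | Atom j => i == j
  | Sum t1 t2 => sum_parity t1 i (+) sum_parity t2 i
  end.

(** In exponent two only the parity of the occurrences of each atom matters, so comparing parities
    is a sound test of equality. *)
Lemma sum_evalE (V : nmodType) (V2 : forall x : V, x + x = 0) (env : seq V) t :
  sum_eval env t = \sum_(i < size env | sum_parity t i) env`_i.
Proof.
elim: t => [|j|t1 IH1 t2 IH2] /=; first by rewrite big_pred0.
  have [ltj|gej] := ltnP j (size env); last first.
    (* An index outside [env] evaluates to the default [0], matching an empty sum. *)
    rewrite nth_default // big_pred0 // => i.
    by apply: contraTF gej => /eqP <-; rewrite -ltnNge.
  by rewrite (big_pred1 (Ordinal ltj)).
rewrite IH1 IH2 big_mkcond [X in _ + X]big_mkcond [RHS]big_mkcond -big_split.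
apply: eq_bigr => i _ /=.
by case: (sum_parity t1 i); case: (sum_parity t2 i); rewrite ?addr0 ?add0r ?V2.
Qed.

Lemma sum_eval_eq (V : nmodType) (V2 : forall x : V, x + x = 0)
    (env : seq V) t1 t2 :
  all (fun i => sum_parity t1 i == sum_parity t2 i) (iota 0 (size env)) ->
  sum_eval env t1 = sum_eval env t2.
Proof.
move=> /allP eq12; rewrite !sum_evalE //; apply: eq_bigl => i.
by apply/eqP/eq12; rewrite mem_iota add0n ltn_ord.
Qed.

Ltac sum_atoms t l :=
  lazymatch t with
  | (?x + ?y)%R => let l' := sum_atoms x l in sum_atoms y l'
  | 0%R => l
  | _ => match l with
         | context [t :: _] => l
         | _ => constr:(t :: l)
         end
  end.

Ltac atom_index t l :=
  lazymatch l with
  | t :: _ => constr:(0%N)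
  | _ :: ?l' => let i := atom_index t l' in constr:(S i)
  end.

Ltac sum_quote t l :=
  lazymatch t with
  | (?x + ?y)%R =>
      let tx := sum_quote x l in let ty := sum_quote y l in constr:(Sum tx ty)
  | 0%R => constr:(Zero)
  | _ => let i := atom_index t l in constr:(Atom i)
  end.

(* Decides equality of sums of atoms in an abelian group of exponent 2. *)
Ltac char2 V2 :=
  lazymatch goal with
  | |- @eq ?V ?x ?y =>
      let l := sum_atoms x (@nil V) in
      let l := sum_atoms y l in
      let tx := sum_quote x l in
      let ty := sum_quote y l in
      exact (@sum_eval_eq _ V2 l tx ty erefl)
  end.

(** * Five-point circuits in rigid sets *)

Section Pentagon.

Variables (V : zmodType) (V2 : forall x : V, x + x = 0) (E : {pred V}).

Definition sum_free := forall x y, x \in E -> y \in E -> x + y \notin E.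

(* Given sum-freeness, this is [I_4]-freeness: the four points need not be
   assumed independent, since the conclusion is automatic for dependent ones. *)
Definition quad_closed := forall x y z t,
  x \in E -> y \in E -> z \in E -> t \in E ->
  [|| x + y + z \in E, x + y + t \in E, x + z + t \in E, y + z + t \in E
    | x + y + z + t \in E].

Hypotheses (E_sf : sum_free) (E_quad : quad_closed).

Lemma mem_sum x y : x \in E -> y = x -> y \in E.
Proof. by move=> xE ->. Qed.

Lemma notin_sum x y t : x \in E -> y \in E -> t = x + y -> t \notin E.
Proof. by move=> xE yE ->; apply: E_sf. Qed.

Lemma sum_absurd x y t : x \in E -> y \in E -> t \in E -> t = x + y -> False.
Proof. by move=> xE yE tE def_t; case/negP: (notin_sum xE yE def_t). Qed.

Lemma quad_absurd x y z t :
  x \in E -> y \in E -> z \in E -> t \in E ->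
  x + y + z \notin E -> x + y + t \notin E -> x + z + t \notin E ->
  y + z + t \notin E -> x + y + z + t \notin E -> False.
Proof.
move=> xE yE zE tE /negbTE n1 /negbTE n2 /negbTE n3 /negbTE n4 /negbTE n5.
by have := E_quad xE yE zE tE; rewrite n1 n2 n3 n4 n5.
Qed.

Ltac mem h := by apply: (mem_sum h); char2 V2.
Ltac nmem h :=
  let h' := fresh in apply: (contra _ h) => h'; mem h'.
Ltac sf h1 h2 := by apply: (notin_sum h1 h2); char2 V2.

Definition pentagon a b c d e :=
  [/\ a \in E, b \in E, c \in E, d \in E & e \in E] /\ e = a + b + c + d.

Ltac perm_pentagon P :=
  by have [[? ? ? ? ?] ?] := P; subst; split; [split | char2 V2].

(** [E_quad] is applied to [c], [d], [e], [z]: here [c + d + e] equals [a + b], which sum-freeness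
    excludes, and adding [z] to it gives the last alternative. *)
Lemma pentagon_triples a b c d e z : pentagon a b c d e -> z \in E ->
  [|| z + (c + d) \in E, z + (c + e) \in E, z + (d + e) \in E
    | z + (a + b) \in E].
Proof.
move=> [[aE bE cE dE eE] def_e] zE; apply: contraT.
rewrite !negb_or => /and4P[n1 n2 n3 n4]; exfalso.
apply: (quad_absurd cE dE eE zE).
- by rewrite def_e; sf aE bE.
- nmem n1.
- nmem n2.
- nmem n3.
- by rewrite def_e; nmem n4.
Qed.

Lemma pentagon_disjoint a b c d e z : pentagon a b c d e ->
  z + (a + b) \in E -> z + (c + d) \notin E.
Proof.
by move=> [[aE bE cE dE eE] def_e] zE; rewrite def_e in eE; sf zE eE.
Qed.

(** If [y + w] were not in [E], then [y] could be translated by every pair of the pentagon, against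
    [pentagon_disjoint]. *)
Lemma pentagon_translate a b c d e w y : pentagon a b c d e ->
  a + w \in E -> b + w \in E -> c + w \in E -> d + w \in E -> e + w \in E ->
  y \in E -> y + w \in E.
Proof.
move=> P aw bw cw dw ew yE; apply: contraT => nyw; exfalso.
have n1 x : x + w \in E -> y + w + x \notin E by move=> xw; sf xw yE.
(* The alternatives of [pentagon_triples] for this point are [y + w] plus [e'], [d'], [c'] or [0],
   all excluded. *)
have n2 a' b' c' d' e' : pentagon a' b' c' d' e' ->
    c' + w \in E -> d' + w \in E -> e' + w \in E -> y + w + (a' + b') \notin E.
  move=> P' cw' dw' ew'; apply/negP => zE.
  have [[_ _ _ _ _] def_e'] := P'.
  have := pentagon_triples P' zE.
  have -> : y + w + (a' + b') + (c' + d') = y + w + e'.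
    by rewrite def_e'; char2 V2.
  have -> : y + w + (a' + b') + (c' + e') = y + w + d'.
    by rewrite def_e'; char2 V2.
  have -> : y + w + (a' + b') + (d' + e') = y + w + c'.
    by rewrite def_e'; char2 V2.
  have -> : y + w + (a' + b') + (a' + b') = y + w by char2 V2.
  by rewrite !(negbTE (n1 _ _)) // (negbTE nyw).
have pair a' b' c' d' e' : pentagon a' b' c' d' e' ->
    a' + w \in E -> b' + w \in E -> c' + w \in E -> d' + w \in E ->
    e' + w \in E -> y + (a' + b') \in E.
  move=> P' aw' bw' cw' dw' ew'.
  have [[aE bE cE dE eE] def_e'] := P'.
  apply: contraT => ny; exfalso.
  apply: (quad_absurd aE bE cw' yE).
  - by rewrite def_e' in ew'; sf dE ew'.
  - nmem ny.
  - have P'' : pentagon a' c' b' d' e' by perm_pentagon P'.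
    have ny' := n2 _ _ _ _ _ P'' bw' dw' ew'; nmem ny'.
  - have P'' : pentagon b' c' a' d' e' by perm_pentagon P'.
    have ny' := n2 _ _ _ _ _ P'' aw' dw' ew'; nmem ny'.
  - have P'' : pentagon d' e' a' b' c' by perm_pentagon P'.
    have ny' := n2 _ _ _ _ _ P'' aw' bw' cw'.
    by rewrite def_e' in ny'; nmem ny'.
have yab : y + (a + b) \in E by apply: pair P _ _ _ _ _.
have P' : pentagon c d a b e by perm_pentagon P.
have ycd : y + (c + d) \in E by apply: pair P' _ _ _ _ _.
by case/negP: (pentagon_disjoint P yab).
Qed.

(** * Triples of the pentagon attached to further points *)

Definition tri a b c y :=
  [/\ y + (a + b) \in E, y + (a + c) \in E & y + (b + c) \in E].

(* The ten variables say which pairs of the pentagon can be added to a fixed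
   point of [E]; the hypotheses are [pentagon_disjoint], then
   [pentagon_triples]. *)
Lemma pairs_star_or_triangle (ab ac ad ae bc bd be cd ce de : bool) :
  ~~ [|| ab && cd, ab && ce, ab && de, ac && bd, ac && be, ac && de,
         ad && bc, ad && be, ad && ce, ae && bc, ae && bd, ae && cd,
         bc && de, bd && ce | be && cd] ->
  [&& [|| cd, ce, de | ab], [|| bd, be, de | ac], [|| bc, be, ce | ad],
      [|| bc, bd, cd | ae], [|| ad, ae, de | bc], [|| ac, ae, ce | bd],
      [|| ac, ad, cd | be], [|| ab, ae, be | cd], [|| ab, ad, bd | ce]
    & [|| ab, ac, bc | de]] ->
  [\/ [|| [&& ab, ac, ad & ae], [&& ab, bc, bd & be], [&& ac, bc, cd & ce],
          [&& ad, bd, cd & de] | [&& ae, be, ce & de]],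
      [|| [&& ab, ac & bc], [&& ab, ad & bd], [&& ab, ae & be],
          [&& ac, ad & cd] | [&& ac, ae & ce]]
    | [|| [&& ad, ae & de], [&& bc, bd & cd], [&& bc, be & ce],
          [&& bd, be & de] | [&& cd, ce & de]]].
Proof.
move=> disj pent3; apply/or3P; move: disj pent3.
by move: ab ac ad ae bc bd be cd ce de; do 10 case.
Qed.


(** Each sum that [E_quad] offers for [y], [y'], [b], [d] splits into two points of [E], for
    instance [y + y' + b] into [y + (a + c)] and [y' + (d + e)]. *)
Lemma tri_meet1 a b c d e y y' : pentagon a b c d e -> y \in E -> y' \in E ->
  tri a b c y -> tri a d e y' -> False.
Proof.
move=> [[aE bE cE dE eE] def_e] yE y'E [yab yac ybc] [yad yae yde]; subst e.
apply: (quad_absurd yE y'E bE dE).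
- sf yac yde.
- sf ybc yae.
- sf yac eE.
- sf yae cE.
- sf yab yad.
Qed.

Lemma tri_meet2_absurd a b c d e y y' : pentagon a b c d e ->
  y \in E -> y' \in E -> tri a b c y -> tri a b d y' ->
  y + y' + c \in E -> False.
Proof.
move=> [[aE bE cE dE eE] def_e] yE y'E [yab yac ybc] [zab zad zbd] ec; subst e.
(* Named after its other form: [a + b + c] is [d + e]. *)
have de : y + y' + (a + b + c) \in E.
  apply: contraT => nde; exfalso.
  apply: (quad_absurd yab y'E cE dE).
  - nmem nde.
  - sf ec eE.
  - sf yE eE.
  - sf zab eE.
  - sf yac zbd.
apply: (quad_absurd yE zad de bE).
- sf aE eE.
- sf ec eE.
- sf zbd eE.
- sf yab eE.
- sf cE dE.
Qed.

(** The preceding lemma excludes [y + y' + c] and, after exchanging [c] with [d] and [y] with [y'],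
    also [y + y' + d]; then [E_quad] fails for [y], [y'], [c], [d]. *)
Lemma tri_meet2 a b c d e y y' : pentagon a b c d e -> y \in E -> y' \in E ->
  tri a b c y -> tri a b d y' -> False.
Proof.
move=> P yE y'E Ty Ty'.
have P' : pentagon a b d c e by perm_pentagon P.
have nc : y + y' + c \notin E.
  by apply/negP => /(tri_meet2_absurd P yE y'E Ty Ty').
have nd : y + y' + d \notin E.
  apply/negP => dE; apply: (tri_meet2_absurd P' y'E yE Ty' Ty).
  by rewrite (addrC y').
move: P Ty Ty' => [[aE bE cE dE eE] def_e] [yab yac ybc] [zab zad zbd]; subst e.
apply: (quad_absurd yE y'E cE dE) => //.
- sf yab eE.
- sf zab eE.
- sf yac zad.
Qed.

(** Serves to prove [u = v] modulo a known equation: [x + y] vanishes, and the remaining goal is an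
    identity for [char2]. *)
Lemma sum_mod x y u v : x = y -> u = v + (x + y) -> u = v :> V.
Proof. by move=> -> ->; rewrite V2 addr0. Qed.

Hypothesis E_rigid : forall w, (forall x, x \in E -> x + w \in E) -> w = 0.

(** With [w = y + a], the hypotheses say that adding [w] keeps all five points of the pentagon in
    [E]. *)
Lemma pentagon_star a b c d e y : pentagon a b c d e -> y \in E ->
  y + (a + b) \in E -> y + (a + c) \in E -> y + (a + d) \in E ->
  y + (a + e) \in E -> y = a.
Proof.
move=> P yE yab yac yad yae.
suff w0 : y + a = 0 by apply: (sum_mod w0); char2 V2.
apply: E_rigid => x; apply: (pentagon_translate P).
- mem yE.
- mem yab.
- mem yac.
- mem yad.
- mem yae.
Qed.

Ltac perm_tri T :=
  let T1 := fresh in let T2 := fresh in let T3 := fresh in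
  have [T1 T2 T3] := T; split; first [mem T1 | mem T2 | mem T3].

(** The pairs that translate [y] are edges on five vertices. They contain a full star or a triangle,
    and a star would force [y] to be its centre. *)
Lemma tri_exists a b c d e y : pentagon a b c d e -> y \in E ->
  y \notin [:: a; b; c; d; e] ->
  tri a b c y \/ tri a b d y \/ tri a b e y \/ tri a c d y \/ tri a c e y \/
  tri a d e y \/ tri b c d y \/ tri b c e y \/ tri b d e y \/ tri c d e y.
Proof.
move=> P yE; rewrite !inE !negb_or => /and5P[ya yb yc yd ye].
have pent3 a' b' c' d' e' (P' : pentagon a' b' c' d' e') :=
  pentagon_triples P' yE.
have disj a' b' c' d' e' : pentagon a' b' c' d' e' ->
    (y + (a' + b') \in E) && (y + (c' + d') \in E) = false.
  move=> P'; apply/negP => /andP[yab].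
  by apply/negP/(pentagon_disjoint P').
have [||star|triangle|triangle] := @pairs_star_or_triangle
  (y + (a + b) \in E) (y + (a + c) \in E) (y + (a + d) \in E)
  (y + (a + e) \in E) (y + (b + c) \in E) (y + (b + d) \in E)
  (y + (b + e) \in E) (y + (c + d) \in E) (y + (c + e) \in E)
  (y + (d + e) \in E).
- rewrite (disj a b c d e) //.
  rewrite (disj a b c e d); last by perm_pentagon P.
  rewrite (disj a b d e c); last by perm_pentagon P.
  rewrite (disj a c b d e); last by perm_pentagon P.
  rewrite (disj a c b e d); last by perm_pentagon P.
  rewrite (disj a c d e b); last by perm_pentagon P.
  rewrite (disj a d b c e); last by perm_pentagon P.
  rewrite (disj a d b e c); last by perm_pentagon P.
  rewrite (disj a d c e b); last by perm_pentagon P.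
  rewrite (disj a e b c d); last by perm_pentagon P.
  rewrite (disj a e b d c); last by perm_pentagon P.
  rewrite (disj a e c d b); last by perm_pentagon P.
  rewrite (disj b c d e a); last by perm_pentagon P.
  rewrite (disj b d c e a); last by perm_pentagon P.
  by rewrite (disj b e c d a) //; perm_pentagon P.
- rewrite (pent3 a b c d e) //.
  rewrite (pent3 a c b d e); last by perm_pentagon P.
  rewrite (pent3 a d b c e); last by perm_pentagon P.
  rewrite (pent3 a e b c d); last by perm_pentagon P.
  rewrite (pent3 b c a d e); last by perm_pentagon P.
  rewrite (pent3 b d a c e); last by perm_pentagon P.
  rewrite (pent3 b e a c d); last by perm_pentagon P.
  rewrite (pent3 c d a b e); last by perm_pentagon P.
  rewrite (pent3 c e a b d); last by perm_pentagon P.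
  by rewrite (pent3 d e a b c) //; perm_pentagon P.
- exfalso.
  case/or4P: star => [||| /orP[]] /and4P[s1 s2 s3 s4].
  + by case/eqP: ya; apply: (pentagon_star P).
  + have P' : pentagon b a c d e by perm_pentagon P.
    by case/eqP: yb; apply: (pentagon_star P') => //; rewrite (addrC b).
  + have P' : pentagon c a b d e by perm_pentagon P.
    by case/eqP: yc; apply: (pentagon_star P') => //; rewrite (addrC c).
  + have P' : pentagon d a b c e by perm_pentagon P.
    by case/eqP: yd; apply: (pentagon_star P') => //; rewrite (addrC d).
  + have P' : pentagon e a b c d by perm_pentagon P.
    by case/eqP: ye; apply: (pentagon_star P') => //; rewrite (addrC e).
- by case/or4P: triangle => [||| /orP[]] /and3P; tauto.
- by case/or4P: triangle => [||| /orP[]] /and3P; tauto.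
Qed.

(** Two different triples of a five-point set share one or two points; [tri_meet1] and [tri_meet2]
    exclude both. *)
Lemma tri_uniform a b c d e y0 : pentagon a b c d e ->
  y0 \in E -> tri a b c y0 ->
  forall y, y \in E -> y \in [:: a; b; c; d; e] \/ tri a b c y.
Proof.
move=> P y0E T0 y yE; case: (boolP (y \in _)) => [|yC]; [by left|right].
have T0' : tri a c b y0 by perm_tri T0.
have T0'' : tri b c a y0 by perm_tri T0.
have [//|[T|[T|[T|[T|[T|[T|[T|[T|T]]]]]]]]] := tri_exists P yE yC; exfalso.
- by apply: (tri_meet2 P y0E yE T0).
- have P' : pentagon a b c e d by perm_pentagon P.
  by apply: (tri_meet2 P' y0E yE T0).
- have P' : pentagon a c b d e by perm_pentagon P.
  by apply: (tri_meet2 P' y0E yE T0').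
- have P' : pentagon a c b e d by perm_pentagon P.
  by apply: (tri_meet2 P' y0E yE T0').
- by apply: (tri_meet1 P y0E yE T0).
- have P' : pentagon b c a d e by perm_pentagon P.
  by apply: (tri_meet2 P' y0E yE T0'').
- have P' : pentagon b c a e d by perm_pentagon P.
  by apply: (tri_meet2 P' y0E yE T0'').
- have P' : pentagon b a c d e by perm_pentagon P.
  by apply: (tri_meet1 P' y0E yE _ T); perm_tri T0.
- have P' : pentagon c a b d e by perm_pentagon P.
  by apply: (tri_meet1 P' y0E yE _ T); perm_tri T0.
Qed.

Definition common_tri a b c d e :=
  pentagon a b c d e /\
  forall y, y \in E -> y \in [:: a; b; c; d; e] \/ tri a b c y.

Lemma common_tri_exists a b c d e y0 : pentagon a b c d e ->
  y0 \in E -> y0 \notin [:: a; b; c; d; e] ->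
  exists a' b' c' d' e', common_tri a' b' c' d' e'.
Proof.
move=> P y0E y0C; have conv a' b' c' d' e' : pentagon a' b' c' d' e' ->
    tri a' b' c' y0 -> exists a' b' c' d' e', common_tri a' b' c' d' e'.
  move=> P' T; exists a', b', c', d', e'; split=> //.
  exact: tri_uniform P' y0E T.
have [T|[T|[T|[T|[T|[T|[T|[T|[T|T]]]]]]]]] := tri_exists P y0E y0C.
- by apply: (conv a b c d e).
- by apply: (conv a b d c e) => //; perm_pentagon P.
- by apply: (conv a b e c d) => //; perm_pentagon P.
- by apply: (conv a c d b e) => //; perm_pentagon P.
- by apply: (conv a c e b d) => //; perm_pentagon P.
- by apply: (conv a d e b c) => //; perm_pentagon P.
- by apply: (conv b c d a e) => //; perm_pentagon P.
- by apply: (conv b c e a d) => //; perm_pentagon P.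
- by apply: (conv b d e a c) => //; perm_pentagon P.
- by apply: (conv c d e a b) => //; perm_pentagon P.
Qed.

(** * The affine subspace and its direction space *)

Definition affine_part d e x :=
  (x == d + e) || (x \in E) && (x \notin [:: d; e]).

Lemma pentagon_neq a b c d e : pentagon a b c d e ->
  a != d /\ a != e.
Proof.
move=> [[aE bE cE dE eE] def_e]; subst e; split; apply/eqP=> eq_a.
- apply: (sum_absurd bE cE eE); apply: (sum_mod eq_a).
  by char2 V2.
- apply: (sum_absurd bE cE dE); apply: (sum_mod eq_a).
  by char2 V2.
Qed.

Lemma affine_partI a b c d e x : pentagon a b c d e -> x \in E ->
  x + (b + c) \in E -> affine_part d e x.
Proof.
move=> [[aE bE cE dE eE] def_e] xE x'E; subst e; rewrite /affine_part xE !inE.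
apply/orP; right; rewrite negb_or /=; apply/andP; split; apply/eqP=> eq_x.
- by rewrite eq_x in x'E; apply: (sum_absurd aE eE x'E); char2 V2.
- by rewrite eq_x in x'E; apply: (sum_absurd aE dE x'E); char2 V2.
Qed.

(** Translation by [b + c] exchanges [d + e] with [a] and [b] with [c]; for the other points it is
    part of [tri]. *)
Lemma affine_part_shift a b c d e x : common_tri a b c d e ->
  affine_part d e x -> affine_part d e (x + (b + c)).
Proof.
move=> [P H]; have [[aE bE cE dE eE] def_e] := P.
case/orP => [/eqP-> | /andP[xE]].
  have -> : d + e + (b + c) = a by rewrite def_e; char2 V2.
  have [ad ae] := pentagon_neq P.
  by rewrite /affine_part aE !inE negb_or ad ae orbT.
rewrite !inE negb_or => /andP[xd xe].
case: (H x xE) => [|[xab xac xbc]]; last first.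
  by apply: (affine_partI P xbc); mem xE.
rewrite !inE (negbTE xd) (negbTE xe) orbF orbF => /or3P[]/eqP->.
- apply/orP; left; apply/eqP; rewrite def_e; char2 V2.
- have -> : b + (b + c) = c by char2 V2.
  have P' : pentagon c a b d e by perm_pentagon P.
  have [ad ae] := pentagon_neq P'.
  by rewrite /affine_part cE !inE negb_or ad ae orbT.
- have -> : c + (b + c) = b by char2 V2.
  have P' : pentagon b a c d e by perm_pentagon P.
  have [ad ae] := pentagon_neq P'.
  by rewrite /affine_part bE !inE negb_or ad ae orbT.
Qed.

Lemma common_triC12 a b c d e : common_tri a b c d e -> common_tri b a c d e.
Proof.
move=> [P H]; split; first by perm_pentagon P.
move=> y /H[|T]; last by right; perm_tri T.
by rewrite !inE orbCA; left.
Qed.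

Lemma common_triC23 a b c d e : common_tri a b c d e -> common_tri a c b d e.
Proof.
move=> [P H]; split; first by perm_pentagon P.
move=> y /H[|T]; last by right; perm_tri T.
by rewrite !inE [X in _ || X]orbCA; left.
Qed.

(** An equality would make [e] the sum of [s] and a translate of [t], both in [E]. *)
Lemma tri_sum_neq a b c d e s t :
  pentagon a b c d e -> s \in E -> tri a b c t ->
  [/\ s + t != a + d, s + t != b + d & s + t != c + d].
Proof.
move=> [[aE bE cE dE eE] def_e] sE [tab tac tbc]; subst e.
split; apply/eqP=> eq_st.
- apply: (sum_absurd sE tbc eE); apply: (sum_mod eq_st).
  by char2 V2.
- apply: (sum_absurd sE tac eE); apply: (sum_mod eq_st).
  by char2 V2.
- apply: (sum_absurd sE tab eE); apply: (sum_mod eq_st).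
  by char2 V2.
Qed.

Lemma tri_sum_mem a b c d e s t : pentagon a b c d e -> s \in E -> t \in E ->
  tri a b c s -> tri a b c t -> s + t + (a + d) \in E -> s + t + b \in E.
Proof.
move=> [[aE bE cE dE eE] def_e] sE tE [sab sac sbc] [tab tac tbc] zE; subst e.
apply: contraT => nb; exfalso.
apply: (quad_absurd sE tE zE bE) => //.
- sf aE dE.
- sf tab dE.
- sf sab dE.
- sf cE eE.
Qed.

(** If both alternatives fail, [E_quad] is contradicted at [s], [t], [a], [d]. To see this, [s + t]
    plus [b], [a + d], [a + e] and [d] are excluded from [E] in turn. *)
Lemma tri_sum a b c d e s t : common_tri a b c d e -> s \in E -> t \in E ->
  tri a b c s -> tri a b c t -> (s + t + a \in E) || (s + t == b + c).
Proof.
move=> [P H] sE tE Ts Tt; have [[aE bE cE dE eE] def_e] := P.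
have P' : pentagon a b c e d by perm_pentagon P.
have [st_ad st_bd st_cd] := tri_sum_neq P sE Tt.
have [st_ae st_be st_ce] := tri_sum_neq P' sE Tt.
apply: contraT; rewrite negb_or => /andP[na st_bc]; exfalso.
have nst : s + t <> 0.
  move=> st0; case/negP: na; apply: (mem_sum aE).
  by apply: (sum_mod st0); char2 V2.
have nst_ab : s + t <> a + b.
  move=> st0; case/negP: na; apply: (mem_sum bE).
  by apply: (sum_mod st0); char2 V2.
have nb : s + t + b \notin E.
  apply/negP => stb; case: (H _ stb) => [|[zab _ _]]; last first.
    by case/negP: na; mem zab.
  rewrite !inE => /or4P[|||/orP[]] /eqP st.
  - by apply: nst_ab; apply: (sum_mod st); char2 V2.
  - by apply: nst; apply: (sum_mod st); char2 V2.
  - by case/eqP: st_bc; apply: (sum_mod st); char2 V2.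
  - by case/eqP: st_bd; apply: (sum_mod st); char2 V2.
  - by case/eqP: st_be; apply: (sum_mod st); char2 V2.
have nad : s + t + (a + d) \notin E.
  by apply: contra nb; apply: (tri_sum_mem P).
have nae : s + t + (a + e) \notin E.
  by apply: contra nb; apply: (tri_sum_mem P').
have nd : s + t + d \notin E.
  apply/negP => std; case: (H _ std) => [|[_ _ zbc]]; last first.
    by case/negP: nae; rewrite def_e; mem zbc.
  rewrite !inE => /or4P[|||/orP[]] /eqP st.
  - by case/eqP: st_ad; apply: (sum_mod st); char2 V2.
  - by case/eqP: st_bd; apply: (sum_mod st); char2 V2.
  - by case/eqP: st_cd; apply: (sum_mod st); char2 V2.
  - by apply: nst; apply: (sum_mod st); char2 V2.
  - have [tab tac tbc] := Tt.
    have n : c \notin E.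
      apply: (notin_sum sE tab); apply: (sum_mod st); rewrite def_e; char2 V2.
    by rewrite cE in n.
have [sab sac sbc] := Ts; have [tab tac tbc] := Tt.
apply: (quad_absurd sE tE aE dE) => //.
- by rewrite def_e in eE; sf sbc eE.
- by rewrite def_e in eE; sf tbc eE.
- nmem nad.
Qed.

(** In exponent two this closure makes the set affine with base point [a]. *)
Lemma affine_part_sum a b c d e s t : common_tri a b c d e ->
  affine_part d e s -> affine_part d e t -> affine_part d e (s + t + a).
Proof.
move=> C; have [P H] := C; have [[aE bE cE dE eE] def_e] := P.
have shift x y : affine_part d e x -> y = x + (a + b) \/ y = x + (a + c) \/
    y = x + (b + c) \/ y = x -> affine_part d e y.
  move=> Ax [->|[->|[->|->]]] //.
  - exact: (affine_part_shift (common_triC12 (common_triC23 C))).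
  - exact: (affine_part_shift (common_triC12 C)).
  - exact: (affine_part_shift C).
(* A summand among [a], [b], [c], [d + e] reduces the claim to one of the translations in
   [shift]. *)
have near x y : affine_part d e x -> affine_part d e y ->
    y \notin E \/ y \in [:: a; b; c] -> affine_part d e (x + y + a).
  move=> Ax Ay hy; apply: (shift _ _ Ax).
  have {hy Ay} : y \in [:: a; b; c; d + e].
    case: hy => [nyE|]; last by rewrite !inE => /or3P[] ->; rewrite ?orbT.
    move: Ay; rewrite /affine_part (negbTE nyE) orbF !inE => ->.
    by rewrite !orbT.
  rewrite !inE => /or4P[] /eqP->.
  - by do 3 right; char2 V2.
  - by left; char2 V2.
  - by right; left; char2 V2.
  - by do 2 right; left; rewrite def_e; char2 V2.
have split x : affine_part d e x ->
    (x \notin E \/ x \in [:: a; b; c]) \/ (x \in E /\ tri a b c x).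
  rewrite /affine_part; case: (boolP (x \in E)) => [xE|]; last by left; left.
  case: (H x xE) => [|T _]; last by right.
  rewrite !inE negb_or => xC; case: (x =P d + e) => [eq_x|_] /=.
    by case/negP: (E_sf dE eE); rewrite -eq_x.
  move=> /andP[xd xe]; left; right; move: xC.
  by rewrite (negbTE xd) (negbTE xe) !orbF.
move=> As At.
have [/(near t s At As)|[sE Ts]] := split s As; first by rewrite (addrC t).
have [/(near s t As At)//|[tE Tt]] := split t At.
(* If [s + t = b + c], then [s + t + a] is the added point [d + e]. *)
have [st|/eqP st] := orP (tri_sum C sE tE Ts Tt); last first.
  apply/orP; left; apply/eqP; apply: (sum_mod st); rewrite def_e; char2 V2.
have P' : pentagon a b c e d by perm_pentagon P.
have [st_ad _ _] := tri_sum_neq P sE Tt.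
have [st_ae _ _] := tri_sum_neq P' sE Tt.
apply/orP; right; rewrite st !inE negb_or /=; apply/andP; split.
  by apply: contra st_ad => /eqP st_ad; apply/eqP/(sum_mod st_ad); char2 V2.
by apply: contra st_ae => /eqP st_ae; apply/eqP/(sum_mod st_ae); char2 V2.
Qed.

(* The direction space of the affine span of [E] minus [d]. *)
Definition direction a d e x :=
  affine_part d e (x + a) || affine_part d e (x + e).

Lemma direction0 a b c d e : common_tri a b c d e -> direction a d e 0.
Proof.
move=> [P _]; have [[aE _ _ _ _] _] := P; have [ad ae] := pentagon_neq P.
by rewrite /direction /affine_part add0r aE !inE negb_or ad ae orbT.
Qed.

Lemma directionD a b c d e x y : common_tri a b c d e ->
  direction a d e x -> direction a d e y -> direction a d e (x + y).
Proof.
move=> C /orP[Ax|Ax] /orP[Ay|Ay]; have A := affine_part_sum C Ax Ay; apply/orP.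
- by left; have <- : x + a + (y + a) + a = x + y + a by char2 V2.
- by right; have <- : x + a + (y + e) + a = x + y + e by char2 V2.
- by right; have <- : x + e + (y + a) + a = x + y + e by char2 V2.
- by left; have <- : x + e + (y + e) + a = x + y + a by char2 V2.
Qed.

(** This lets a functional vanish on the direction space but not at [a], hence nowhere on [E] minus
    [d]. *)
Lemma direction_proper a b c d e : common_tri a b c d e -> ~~ direction a d e a.
Proof.
move=> [P _]; have [[aE bE cE dE eE] def_e] := P; subst e.
have n0 : 0 \notin E by rewrite -(V2 a) E_sf.
rewrite /direction /affine_part (V2 a) (negbTE n0) (negbTE (E_sf aE eE)) !orbF.
rewrite negb_or; apply/andP; split; apply/eqP => eq0.
- apply: (sum_absurd aE bE cE); apply: (sum_mod eq0).
  by char2 V2.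
- apply: (sum_absurd bE cE eE); apply: (sum_mod eq0).
  by char2 V2.
Qed.

Lemma direction_mem a b c d e x : common_tri a b c d e ->
  x \in E -> x != d -> direction a d e (x + a).
Proof.
move=> [P _] xE xd; have [[aE bE cE dE eE] def_e] := P.
have [ad ae] := pentagon_neq P; apply/orP; have [->|xe] := eqVneq x e.
  right; have -> : e + a + e = a by char2 V2.
  by rewrite /affine_part aE !inE negb_or ad ae orbT.
left; have -> : x + a + a = x by char2 V2.
by rewrite /affine_part xE !inE negb_or xd xe orbT.
Qed.

End Pentagon.

(** * Odd circuits and separating functionals *)

Section OddCircuit.

Variables (V : zmodType) (V2 : forall x : V, x + x = 0) (E : {pred V}).
Hypotheses (E_sf : sum_free E) (E_quad : quad_closed E).

(* In a shortest odd circuit, four points whose sum is not in [E] have a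
   three-term sum in [E], which shortens the circuit by two. *)
Lemma odd_circuit_pentagon s : {subset s <= E} -> odd (size s) ->
  \sum_(x <- s) x = 0 -> exists a b c d e, pentagon E a b c d e.
Proof.
have [m] := ubnP (size s); elim: m s => // m IH [|a [|b [|c [|d s]]]] //.
(* Circuits of one or three points contradict sum-freeness. *)
- move=> _ sE _; rewrite big_seq1 => a0; have aE : a \in E by apply/sE/mem_head.
  by case/negP: (E_sf aE aE); rewrite V2 -a0.
- move=> _ sE _; rewrite !big_cons big_nil addr0 => abc0.
  have aE : a \in E by apply: sE; rewrite !inE eqxx.
  have bE : b \in E by apply: sE; rewrite !inE eqxx orbT.
  have cE : c \in E by apply: sE; rewrite !inE eqxx !orbT.
  case: (sum_absurd E_sf bE cE aE); apply: (sum_mod V2 abc0); char2 V2.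
move=> sm sE os; rewrite !big_cons; set r := \sum_(x <- s) x => sum0.
have aE : a \in E by apply: sE; rewrite !inE eqxx.
have bE : b \in E by apply: sE; rewrite !inE eqxx orbT.
have cE : c \in E by apply: sE; rewrite !inE eqxx !orbT.
have dE : d \in E by apply: sE; rewrite !inE eqxx !orbT.
have sE' x : x \in s -> x \in E by move=> xs; apply: sE; rewrite !inE xs !orbT.
have shorten x y : x \in E -> y \in E -> x + (y + r) = 0 ->
    exists a b c d e, pentagon E a b c d e.
  move=> xE yE sum0'; apply: (IH [:: x, y & s]).
  - by rewrite ltnS in sm; apply: ltnW.
  - by move=> z; rewrite !inE => /or3P[/eqP->|/eqP->|/sE'].
  - by move: os; rewrite /= !negbK.
  - by rewrite !big_cons.
have [xE|xE|xE|/orP[xE|xE]] := or4P (E_quad aE bE cE dE).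
- by apply: (shorten _ _ xE dE); rewrite -[RHS]sum0 !addrA.
- by apply: (shorten _ _ xE cE); apply: (sum_mod V2 sum0); char2 V2.
- by apply: (shorten _ _ xE bE); apply: (sum_mod V2 sum0); char2 V2.
- by apply: (shorten _ _ xE aE); apply: (sum_mod V2 sum0); char2 V2.
- by exists a, b, c, d, (a + b + c + d).
Qed.
End OddCircuit.

(** * Linear functionals over [F_2] *)

Lemma F2_rV_addxx n (x : 'rV['F_2]_n) : x + x = 0.
Proof.
by apply/rowP => i; rewrite !mxE; apply: addrr_pchar2; apply: pchar_Fp.
Qed.

Lemma F2_mx11 (x : 'M['F_2]_1) : x != 0 -> x = 1.
Proof.
rewrite [x]mx11_scalar; case: (x 0 0) => [[|[|i]] lti] //.
  move/eqP; case; apply/rowP => j; rewrite !mxE; case: eqP => // _.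
  exact: val_inj.
by move=> _; congr (_%:M); apply: val_inj.
Qed.

(* Over [F_2] a set closed under addition is a subspace. *)
Lemma separating_functional n (D : 'rV['F_2]_n -> Prop) (B : {set 'rV['F_2]_n})
    (u : 'rV['F_2]_n) :
  D 0 -> (forall x y, D x -> D y -> D (x + y)) -> (forall x, x \in B -> D x) ->
  D u \/ exists f : 'cV['F_2]_n,
    (forall x, x \in B -> x *m f = 0) /\ u *m f != 0.
Proof.
move=> D0 DD BD; pose A : 'M['F_2]_(#|B|, n) := \matrix_i enum_val i.
have rowA i : row i A = enum_val i by rewrite rowK.
case: (boolP (u <= A)%MS) => [/submxP[v ->]|uA].
  left; rewrite mulmx_sum_row; elim/big_rec: _ => // i x _ Dx; apply: DD => //.
  rewrite rowA; case: (v 0 i) => [[|[|j]] ltj] //.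
    by rewrite (_ : Ordinal ltj = 0) ?scale0r //; apply: val_inj.
  rewrite (_ : Ordinal ltj = 1) ?scale1r; last exact: val_inj.
  exact/BD/enum_valP.
right; rewrite submxE in uA.
(* Each column of [cokermx A] vanishes on the row space of [A]; as [u] lies outside it, some column
   detects [u]. *)
have /existsP[j uj] : [exists j, col j (u *m cokermx A) != 0].
  apply: contraNT uA; rewrite negb_exists => /forallP u0.
  apply/eqP/rowP => j; have /negPn/eqP/rowP/(_ 0) := u0 j.
  by rewrite !mxE.
exists (col j (cokermx A)); split; last by move: uj; rewrite !colE -mulmxA.
move=> x xB; rewrite colE mulmxA.
suff -> : x *m cokermx A = 0 by rewrite mul0mx.
apply/eqP; rewrite -submxE; have -> : x = row (enum_rank_in xB x) A.
  by rewrite rowA enum_rankK_in.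
exact: row_sub.
Qed.

(** Fix [b] in [E]. If [b] is a sum of evenly many points of [E], prepending it gives an odd
    circuit; otherwise a functional kills every [b + x] but not [b], so it is nonzero on [E]. *)
Lemma hyperplane_or_odd_circuit n (E : {set 'rV['F_2]_n}) :
  (exists f : 'cV['F_2]_n, forall x, x \in E -> x *m f != 0) \/
  exists s : seq 'rV['F_2]_n,
    [/\ {subset s <= E}, odd (size s) & \sum_(x <- s) x = 0].
Proof.
have [->|[b bE]] := set_0Vmem E; first by left; exists 0 => x; rewrite inE.
pose D x := exists s : seq 'rV['F_2]_n,
  [/\ {subset s <= E}, ~~ odd (size s) & \sum_(y <- s) y = x].
have [|||[s [sE os sum_s]]|[f [f0 fb]]] :=
  @separating_functional n D [set b + x | x in E] b.
- by exists [::]; split; rewrite ?big_nil.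
- move=> x y [s [sE os <-]] [t [tE ot <-]]; exists (s ++ t); split.
  + by move=> z; rewrite mem_cat => /orP[/sE|/tE].
  + by rewrite size_cat oddD (negbTE os) (negbTE ot).
  + by rewrite big_cat.
- move=> _ /imsetP[x xE ->]; exists [:: b; x]; split=> //.
    by move=> z; rewrite !inE => /orP[] /eqP->.
  by rewrite !big_cons big_nil addr0.
- right; exists (b :: s); split=> //=.
    by move=> z; rewrite inE => /orP[/eqP->|/sE].
  by rewrite big_cons sum_s F2_rV_addxx.
left; exists f => x xE; apply: contra fb => /eqP fx.
by have := f0 (b + x) (imset_f _ xE); rewrite mulmxDl fx addr0 => ->.
Qed.

Lemma quad_closedI (V : zmodType) (E H : {pred V}) :
  (forall x y, x \in H -> y \in H -> x + y \in H) ->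
  quad_closed E -> quad_closed [predI E & H].
Proof.
move=> HD E_quad x y z t /andP[xE xH] /andP[yE yH] /andP[zE zH] /andP[tE tH].
by rewrite !inE !HD ?andbT //; apply: E_quad.
Qed.

(** The induction is on the size of [E], so that restricting to a hyperplane stays in the same
    ambient space. *)
Lemma two_functionals n (E : {set 'rV['F_2]_n}) :
  sum_free (mem E) -> quad_closed (mem E) ->
  exists f g : 'cV['F_2]_n,
    forall x, x \in E -> (x *m f != 0) || (x *m g != 0).
Proof.
have V2 := @F2_rV_addxx n.
have [m] := ubnP #|E|; elim: m E => // m IH E ltEm E_sf E_quad.
have [[f f1]|[s [sE os sum_s]]] := hyperplane_or_odd_circuit E.
  by exists f, 0 => x /f1 ->.
have [a [b [c [d [e P]]]]] := odd_circuit_pentagon V2 E_sf E_quad sE os sum_s.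
have [/existsP[w /andP[w0 /forall_inP Ew]]|rigid] :=
  boolP [exists w : 'rV['F_2]_n, (w != 0) && [forall x in E, x + w \in E]].
  (* Separating [w] from the zero subspace yields a hyperplane that avoids [w]. *)
  have [||||[h [_ wh]]] := @separating_functional n (eq^~ 0) set0 w.
  - by [].
  - by move=> x y -> ->; rewrite addr0.
  - by move=> x; rewrite inE.
  - by move/eqP; rewrite (negbTE w0).
  pose H := [pred x : 'rV['F_2]_n | x *m h == 0].
  have wh1 := F2_mx11 wh.
  have HD x y : x \in H -> y \in H -> x + y \in H.
    by rewrite !inE mulmxDl => /eqP-> /eqP->; rewrite addr0.
  have Hw x : x *m h != 0 -> x + w \in H.
    by move=> xh; rewrite inE mulmxDl wh1 (F2_mx11 xh) F2_rV_addxx.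
  have [|||f [g fg]] := IH [set x in E | x *m h == 0].
  (* The restriction is smaller because [a] or [a + w] is a point of [E] off the hyperplane. *)
  - rewrite ltnS in ltEm; apply: leq_trans ltEm; apply: proper_card.
    apply/properP; split; first by apply/subsetP => x; rewrite inE => /andP[].
    have [aE _ _ _ _] := proj1 P; have [ah|ah] := eqVneq (a *m h) 0.
      exists (a + w); first exact: Ew.
      by rewrite inE mulmxDl ah add0r (negbTE wh) andbF.
    by exists a; rewrite // inE (negbTE ah) andbF.
  - move=> x y; rewrite !inE => /andP[xE _] /andP[yE _].
    by rewrite negb_and E_sf.
  - move=> x y z t; rewrite !inE.
    by apply: (quad_closedI HD E_quad).
  (* The matrix [1%:M + h *m w] projects onto the kernel of [h] along [w] and maps [E] into its
     restriction. *)
  - exists ((1%:M + h *m w) *m f), ((1%:M + h *m w) *m g) => x xE.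
    rewrite !mulmxA mulmxDr mulmx1 mulmxA.
    have [xh|xh] := eqVneq (x *m h) 0.
      by rewrite xh mul0mx addr0 fg // inE xE xh eqxx.
    by rewrite (F2_mx11 xh) mul1mx fg // inE Ew //; apply: Hw.
have {}rigid w : (forall x, x \in E -> x + w \in E) -> w = 0.
  move=> Ew; apply: contraNeq rigid => w0; apply/existsP; exists w.
  by rewrite w0; apply/forall_inP.
have [a' [b' [c' [d' [e' C]]]]] : exists a' b' c' d' e',
    common_tri (mem E) a' b' c' d' e'.
  (* If [E] has no point outside the pentagon, any triple serves. *)
  have [|/subsetPn[y yE yC]] := boolP (E \subset [:: a; b; c; d; e]).
    by move=> /subsetP sub; exists a, b, c, d, e; split=> // y /sub; left.
  exact: (common_tri_exists V2 E_sf E_quad rigid P yE yC).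
move: a' b' c' d' e' C => {a b c d e P} a b c d e C.
have [||||[f [f0 fa]]] := @separating_functional n
  (direction (mem E) a d e) [set x | direction (mem E) a d e x] a.
- exact: direction0 C.
- by move=> x y; apply: directionD C.
- by move=> x; rewrite inE.
- by move=> Da; have := direction_proper V2 E_sf C; rewrite Da.
have [||||[g [_ dg]]] := @separating_functional n (eq^~ 0) set0 d.
- by [].
- by move=> x y -> ->; rewrite addr0.
- by move=> x; rewrite inE.
- have [[_ _ _ dE _] _] := proj1 C; move=> d0.
  by case/negP: (E_sf _ _ dE dE); rewrite V2 -d0.
exists f, g => x xE; have [->|xd] := eqVneq x d; first by rewrite dg orbT.
apply/orP; left; apply: contra fa => /eqP xf.
have := f0 (x + a); rewrite inE (direction_mem V2 E_sf C xE xd).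
by rewrite mulmxDl xf add0r => ->.
Qed.

(** * Flats and the critical number *)

Definition flat_of n (U : {vspace 'rV['F_2]_n}) : {set 'rV['F_2]_n} :=
  [set x in U | x != 0].

Lemma span_flat_of n (U : {vspace 'rV['F_2]_n}) : <<enum (flat_of U)>>%VS = U.
Proof.
apply/eqP; rewrite eqEsubv; apply/andP; split.
  by apply/span_subvP => x; rewrite mem_enum inE => /andP[].
apply/subvP => x xU; have [->|x0] := eqVneq x 0; first exact: mem0v.
by apply: memv_span; rewrite mem_enum inE xU.
Qed.

Lemma flat_flat_of n (U : {vspace 'rV['F_2]_n}) : flat (flat_of U).
Proof.
rewrite /flat span_flat_of; apply/andP; split.
  by apply/subsetP => x; rewrite !inE => /andP[].
apply/eqP/setP => x; rewrite !inE.
by case: eqP => [->|_]; rewrite ?mem0v ?andbT ?orbF ?orbT.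
Qed.

(** Iterated, this expands membership in the span of an explicit list into a disjunction over
    partial sums. *)
Lemma F2_span_cons n (x : 'rV['F_2]_n) s y :
  (y \in <<x :: s>>%VS) = (y \in <<s>>%VS) || (y + x \in <<s>>%VS).
Proof.
rewrite span_cons; apply/idP/orP => [/memv_addP[_ /vlineP[k ->] [z zs ->]]|].
  case: k => [[|[|i]] lti] //.
    by left; rewrite (_ : Ordinal lti = 0) ?scale0r ?add0r //; apply: val_inj.
  right; rewrite (_ : Ordinal lti = 1) ?scale1r; last exact: val_inj.
  by rewrite addrAC F2_rV_addxx add0r.
case=> [ys|ys]; first by rewrite -[y]add0r memv_add ?mem0v.
have -> : y = x + (y + x) by rewrite addrCA F2_rV_addxx addr0.
by rewrite memv_add ?memv_line.
Qed.

Lemma F2_mem_span0 n (y : 'rV['F_2]_n) : (y \in <<[::]>>%VS) = (y == 0).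
Proof. by rewrite span_nil memv0. Qed.

(** If [x + y] were in [E], it would be nonzero, so [x], [y], [x + y] would form a triangle inside
    [E]. *)
Lemma triangle_free_sum_free n (M : matroid n) :
  triangle_free M -> sum_free (mem (elements M)).
Proof.
move=> Mt x y xE yE; apply/negP => xyE; apply: Mt.
have n0 z : z \in elements M -> z != 0.
  by move/(subsetP (elements_sub M)); rewrite !inE.
exists (flat_of <<[:: x; y]>>); split.
  rewrite /triangle flat_flat_of /flat_dim span_flat_of.
  suff /eqP -> : free [:: x; y] by [].
  rewrite !free_cons nil_free andbT F2_mem_span0 F2_span_cons !F2_mem_span0.
  by rewrite negb_or !n0.
apply/subsetP => z.
rewrite inE !F2_span_cons !F2_mem_span0 => /andP[+ /negbTE z0].
have V2 := @F2_rV_addxx n; rewrite z0 /= => /or3P[] /eqP z_eq.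
- by apply: (mem_sum yE); apply: (sum_mod V2 z_eq); char2 V2.
- by apply: (mem_sum xE); apply: (sum_mod V2 z_eq); char2 V2.
- by apply: (mem_sum xyE); apply: (sum_mod V2 z_eq); char2 V2.
Qed.

(** If all five sums avoid [E], then [x], [y], [z], [t] are independent and are the only points of
    [E] in their span, as sum-freeness excludes the two-term sums. *)
Lemma I4_free_quad_closed n (M : matroid n) :
  I4_free M -> sum_free (mem (elements M)) -> quad_closed (mem (elements M)).
Proof.
have V2 := @F2_rV_addxx n; set E := elements M.
move=> MI4 E_sf x y z t xE yE zE tE; apply: contraT.
rewrite !negb_or => /and5P[nxyz nxyt nxzt nyzt nxyzt]; exfalso; apply: MI4.
have n0 u : u \in E -> u == 0 = false.
  by move/(subsetP (elements_sub M)); rewrite !inE => /negbTE.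
(* If [u + v] were zero, [u + v + w] would be [w], a point of [E]. *)
have n2 u v w : w \in E -> u + v + w \notin E -> u + v == 0 = false.
  move=> wE; apply: contraNF => /eqP uv0.
  by apply: (mem_sum wE); apply: (sum_mod V2 uv0); char2 V2.
have n3 u v w : u \in E -> v \in E -> w \in E -> u + v + w == 0 = false.
  move=> uE vE wE; apply/eqP => uvw0; apply: (sum_absurd E_sf uE vE wE).
  by apply: (sum_mod V2 uvw0); char2 V2.
have free_s : free [:: x; y; z; t].
  rewrite !free_cons nil_free !F2_span_cons !F2_mem_span0.
  rewrite (n3 x y z) // (n3 x y t) // (n3 x z t) // (n3 y z t) //.
  rewrite (n2 x y z) // (n2 x z y) //; last by rewrite addrAC.
  rewrite (n2 y z x) //; last by rewrite addrC addrA.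
  rewrite (n2 x t y) //; last by rewrite addrAC.
  rewrite (n2 y t x) //; last by rewrite addrC addrA.
  rewrite (n2 z t x) //; last by rewrite addrC addrA.
  rewrite (n0 x) // (n0 y) // (n0 z) // (n0 t) //= andbT.
  apply/eqP => xyzt0; case/negP: nyzt; apply: (mem_sum xE).
  by apply: (sum_mod V2 xyzt0); char2 V2.
have Es : enum (E :&: flat_of <<[:: x; y; z; t]>>) =i [:: x; y; z; t].
  move=> w; rewrite mem_enum !inE; apply/idP/idP; last first.
    move=> ws; have wE : w \in E by case/or4P: ws => /eqP->.
    by rewrite wE n0 // andbT memv_span // !inE.
  case/and3P=> wE; rewrite !F2_span_cons !F2_mem_span0 => ws /negbTE w0.
  have sum_notin u : u \notin E -> w + u == 0 = false.
    move=> nuE; apply/eqP => wu0; case/negP: nuE; apply: (mem_sum wE).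
    by apply: (sum_mod V2 wu0); char2 V2.
  have w2 u v : u \in E -> v \in E -> w + u + v == 0 = false.
    by move=> uE vE; rewrite -addrA sum_notin ?E_sf.
  have w3 u v r : u + v + r \notin E -> w + u + v + r == 0 = false.
    by move=> nuvr; rewrite -!addrA sum_notin ?addrA.
  have w4 : w + x + y + z + t == 0 = false.
    by rewrite -!addrA sum_notin ?addrA.
  move: ws; rewrite w0 !w2 // !w3 // w4 !orbF -!orbA /=.
  have weq u : w + u == 0 -> w == u.
    by move=> /eqP wu; apply/eqP/(sum_mod V2 wu); char2 V2.
  by case/or4P => /weq ->; rewrite ?orbT.
exists (flat_of <<[:: x; y; z; t]>>); split; first exact: flat_flat_of.
  by rewrite /flat_dim span_flat_of; apply/eqP.
rewrite span_flat_of basisEfree (eq_span Es) subvv andTb.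
have perm_s :
    perm_eq (enum (E :&: flat_of <<[:: x; y; z; t]>>)) [:: x; y; z; t].
  by apply: uniq_perm => //; [apply: enum_uniq | apply: free_uniq].
by rewrite (perm_free perm_s) free_s (perm_size perm_s) (eqP free_s).
Qed.

(** By rank-nullity the common kernel of [f] and [g] has codimension at most two, and its nonzero
    vectors form a flat that misses [E]. *)
Lemma critical_number_le2 n (M : matroid n) (f g : 'cV['F_2]_n) :
  (forall x, x \in elements M -> (x *m f != 0) || (x *m g != 0)) ->
  (critical_number M <= 2)%N.
Proof.
move=> fg; pose phi := linfun (mulmxr (row_mx f g) : 'rV_n -> 'rV_(1 + 1)).
have phiE x : (x \in lker phi) = (x *m f == 0) && (x *m g == 0).
  by rewrite memv_ker lfunE /= mul_mx_row row_mx_eq0.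
have dim_phi : (n <= \dim (lker phi) + 2)%N.
  have := limg_ker_dim phi fullv; rewrite capfv !dimvf /= => dim_n.
  have le2 : (\dim (limg phi) <= 2)%N.
    by rewrite (leq_trans (dimvS (subvf _))) // dimvf.
  rewrite [X in _ = X]mul1n in dim_n.
  by apply: (@leq_trans (\dim (lker phi) + \dim (limg phi)));
    [rewrite dim_n | rewrite leq_add2l].
rewrite /critical_number leq_subLR (leq_trans dim_phi) // leq_add2r.
have -> : \dim (lker phi) = flat_dim (flat_of (lker phi)).
  by rewrite /flat_dim span_flat_of.
apply: (@leq_bigmax_cond _ _ (@flat_dim n)); rewrite flat_flat_of /=.
apply/subsetP => x; rewrite !inE phiE => /andP[/andP[/eqP xf /eqP xg] ->].
by rewrite andbT; apply/negP => /fg; rewrite xf xg eqxx.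
Qed.

Theorem corollary3p5 (n : nat) (n_ge1 : (1 <= n)%N) (M : matroid n)
    (M_I4_free : I4_free M) (M_triangle_free : triangle_free M) :
  (critical_number M <= 2)%N.
Proof.
have E_sf := triangle_free_sum_free M_triangle_free.
have E_quad := I4_free_quad_closed M_I4_free E_sf.
have [f [g fg]] := two_functionals E_sf E_quad.
exact: critical_number_le2 fg.
Qed.
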